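(* Let $X=\ell_q$ (complex) with $1<q<\infty$. A typical $T\in(\mathcal{P}_1(X),\mathrm{SOT})$ is such that $T^*$ is not an isometry, and likewise a typical $T\in(\mathcal{P}_1(X),\mathrm{SOT}^* )$ is such that $T^*$ is not an isometry.
   Context: $X=\ell_q=\ell_q(\mathbb{Z}_+)$ is equipped with its canonical basis. A vector is positive if all its coordinates are $\ge0$; a bounded operator $T$ on $X$ is positive if it maps positive vectors to positive vectors. $\mathcal{P}_1(X)$ is the set of bounded positive operators with $\|T\|\le1$. $T^*$ is the adjoint acting on $X^*$; isometries are not assumed surjective. $\mathrm{SOT}$: $T_i\to T$ iff $\|T_ix-Tx\|\to0$ for every $x\in X$. $\mathrm{SOT}^*$: $T_i\to T$ iff $\|T_ix-Tx\|\to0$ for every $x\in X$ and $\|T_i^*x^*-T^*x^*\|\to0$ for every $x^*\in X^*$. ''A typical $T\in(\mathcal{P}_1(X),\tau)$ has property (P)'' means that the set of $T\in\mathcal{P}_1(X)$ with (P) is comeager, i.e. contains a dense $G_\delta$ subset of $(\mathcal{P}_1(X),\tau)$. *)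

(* Defs.v *)
From HB Require Import structures.
From mathcomp Require Import all_boot all_order all_algebra.
From mathcomp Require Import complex.
From mathcomp Require Import all_classical all_reals all_analysis.
From mathcomp Require Import borel_hierarchy.

Set Implicit Arguments.
Unset Strict Implicit.
Unset Printing Implicit Defensive.

Import Order.TTheory GRing.Theory Num.Theory.
Import numFieldNormedType.Exports.

Local Open Scope classical_set_scope.
Local Open Scope ring_scope.
Local Open Scope complex_scope.

Definition comeager {T : topologicalType} (A : set T) :=
  exists G : set T, [/\ Gdelta G, dense G & G `<=` A].

(* The norm of a [normedModType R[i]] takes its values in the nonnegative real
   elements of R[i]; [rnorm] is the same number, seen in R. *)
Section rnorm.
Context {R : realType} {V : normedModType R[i]}.
Implicit Types x y : V.

Definition rnorm x : R := complex.Re `|x|.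

Lemma rnormE x : (rnorm x)%:C = `|x|.
Proof.
rewrite /rnorm; have := normr_ge0 x; case: (`|x|) => a b.
by rewrite lecE /= => /andP[/eqP -> _].
Qed.

Lemma rnorm_ge0 x : 0 <= rnorm x.
Proof. by rewrite -lecR rnormE normr_ge0. Qed.

Lemma rnormD x y : rnorm (x + y) <= rnorm x + rnorm y.
Proof. by rewrite -lecR rmorphD /= !rnormE ler_normD. Qed.

Lemma rnorm0 : rnorm 0 = 0.
Proof. by rewrite /rnorm normr0. Qed.

Lemma rnorm_eq0 x : rnorm x = 0 -> x = 0.
Proof.
by move=> x0; apply/eqP; rewrite -normr_eq0 -rnormE x0.
Qed.

End rnorm.

Lemma rnormZ {R : realType} {V : normedModType R[i]} (a : R[i]) (x : V) :
  rnorm (a *: x) = rnorm (a : R[i]^o) * rnorm x.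
Proof.
by apply: complexI; rewrite rmorphM /= !rnormE normrZ.
Qed.

Section bounded_operators.
Context {R : realType}.
Variables V W : normedModType R[i].

Definition bounded_linear : {pred V -> W} :=
  [pred f | `[< linear f /\
                exists M : R, forall x, rnorm (f x) <= M * rnorm x >]].

Lemma bounded_linear_submod_closed : submod_closed bounded_linear.
Proof.
split.
  apply/asboolP; split.
    by move=> a x y /=; rewrite scaler0 addr0.
  by exists 0 => x; rewrite mul0r rnorm0.
move=> a f g /asboolP[lf [M Mf]] /asboolP[lg [N Ng]].
apply/asboolP; split.
  move=> b x y; rewrite !fctE lf lg.
  by rewrite !scalerDr !scalerA mulrC -!addrA; congr +%R; rewrite addrCA.
exists (rnorm (a : R[i]^o) * M + N) => x.
rewrite !fctE (le_trans (rnormD _ _))// rnormZ mulrDl lerD// -mulrA.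
by rewrite ler_wpM2l ?rnorm_ge0.
Qed.

HB.instance Definition _ := GRing.isSubmodClosed.Build _ _ bounded_linear
  bounded_linear_submod_closed.

Record bounded_op := BoundedOp {
  bounded_op_fun :> V -> W;
  bounded_opP : bounded_op_fun \in bounded_linear }.

HB.instance Definition _ := [isSub for bounded_op_fun].
HB.instance Definition _ := [Choice of bounded_op by <:].
HB.instance Definition _ := [SubChoice_isSubLmodule of bounded_op by <:].

Lemma bounded_op_linear (f : bounded_op) : linear f.
Proof. by have /asboolP[] := bounded_opP f. Qed.

HB.instance Definition _ (f : bounded_op) :=
  GRing.isLinear.Build R[i] V W *:%R f (bounded_op_linear f).

Lemma bounded_op_bounded (f : bounded_op) :
  exists M : R, forall x, rnorm (f x) <= M * rnorm x.
Proof. by have /asboolP[] := bounded_opP f. Qed.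

Definition opnorm (f : bounded_op) : R :=
  sup [set rnorm (f x) | x in [set x : V | rnorm x <= 1]].

Let has_sup_opnorm (f : bounded_op) :
  has_sup [set rnorm (f x) | x in [set x : V | rnorm x <= 1]].
Proof.
split; first by exists (rnorm (f 0)), 0 => //=; rewrite rnorm0.
have [M Mf] := bounded_op_bounded f.
exists `|M| => _ [x /= x1 <-].
rewrite (le_trans (Mf x))// (le_trans (ler_wpM2r (rnorm_ge0 _) (ler_norm M)))//.
by rewrite ler_piMr.
Qed.

Lemma le_opnorm1 (f : bounded_op) x : rnorm x <= 1 -> rnorm (f x) <= opnorm f.
Proof. by move=> x1; apply: sup_upper_bound => //; exists x. Qed.

Lemma opnorm_ge0 (f : bounded_op) : 0 <= opnorm f.
Proof.
by apply: le_trans (le_opnorm1 f (x := 0) _); rewrite ?rnorm_ge0// rnorm0.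
Qed.

Lemma opnorm_le (f : bounded_op) (M : R) :
  (forall x, rnorm x <= 1 -> rnorm (f x) <= M) -> opnorm f <= M.
Proof.
move=> fM; apply: ge_sup; first by have [] := has_sup_opnorm f.
by move=> _ [x /= x1 <-]; exact: fM.
Qed.

Lemma le_opnorm (f : bounded_op) x : rnorm (f x) <= opnorm f * rnorm x.
Proof.
have [->|x0] := eqVneq x 0; first by rewrite linear0 !rnorm0 mulr0.
have nx0 : 0 < rnorm x.
  rewrite lt_neqAle rnorm_ge0 andbT eq_sym.
  by apply: contra_neq x0; exact: rnorm_eq0.
have nV : rnorm (((rnorm x)^-1)%:C : R[i]^o) = (rnorm x)^-1.
  apply: complexI; rewrite rnormE ger0_norm// ler0c invr_ge0.
  exact: rnorm_ge0.
have := @le_opnorm1 f (((rnorm x)^-1)%:C *: x).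
rewrite linearZ /= !rnormZ nV mulVf ?gt_eqF// => /(_ (lexx _)).
by rewrite ler_pdivrMl// mulrC.
Qed.

Lemma opnormD (f g : bounded_op) : opnorm (f + g) <= opnorm f + opnorm g.
Proof.
apply: opnorm_le => x x1; rewrite (le_trans (rnormD (f x) (g x)))//.
by rewrite lerD// le_opnorm1.
Qed.

Lemma opnormZ (a : R[i]) (f : bounded_op) :
  opnorm (a *: f) = rnorm (a : R[i]^o) * opnorm f.
Proof.
have le_opnormZ b g : opnorm (b *: g) <= rnorm (b : R[i]^o) * opnorm g.
  apply: opnorm_le => x x1; rewrite [X in rnorm X](_ : _ = b *: g x)//.
  by rewrite rnormZ ler_wpM2l ?rnorm_ge0// le_opnorm1.
apply/eqP; rewrite eq_le le_opnormZ /=.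
have [->|a0] := eqVneq a 0; first by rewrite rnorm0 mul0r opnorm_ge0.
have na0 : 0 < rnorm (a : R[i]^o).
  rewrite lt_neqAle rnorm_ge0 andbT eq_sym.
  by apply: contra_neq a0; exact: rnorm_eq0.
have := le_opnormZ a^-1 (a *: f); rewrite scalerA mulVf// scale1r.
suff -> : rnorm (a^-1 : R[i]^o) = (rnorm (a : R[i]^o))^-1.
  by rewrite ler_pdivlMl.
by apply: complexI; rewrite fmorphV /= !rnormE normfV.
Qed.

Let opnormC (f : bounded_op) : R[i] := (opnorm f)%:C.

Let opnormCD f g : opnormC (f + g) <= opnormC f + opnormC g.
Proof. by rewrite /opnormC -rmorphD lecR opnormD. Qed.

Let opnormCZ a f : opnormC (a *: f) = `|a| * opnormC f.
Proof. by rewrite /opnormC opnormZ rmorphM /= rnormE. Qed.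

Let opnormC_eq0 f : opnormC f = 0 -> f = 0.
Proof.
move=> /complexI f0; apply/val_inj/funext => x /=; apply: rnorm_eq0.
by apply/eqP; rewrite eq_le rnorm_ge0 (le_trans (le_opnorm f x))// f0 mul0r.
Qed.

HB.instance Definition _ := Lmodule_isNormed.Build R[i] bounded_op
  opnormCD opnormCZ opnormC_eq0.

Lemma bounded_op_normE (f : bounded_op) : `|f| = (opnorm f)%:C.
Proof. by []. Qed.

End bounded_operators.

Arguments bounded_linear {R} V W.

Notation dual V := (bounded_op V (complex _)^o).

Section adjoint.
Context {R : realType} {V W : normedModType R[i]}.
Implicit Type T : bounded_op V W.

Lemma comp_bounded_linear T (f : dual W) :
  (f : W -> R[i]^o) \o T \in bounded_linear V R[i]^o.
Proof.
apply/asboolP; split; first by move=> a x y /=; rewrite !linearP.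
exists (opnorm f * opnorm T) => x /=.
rewrite (le_trans (le_opnorm f _))// -mulrA.
by rewrite ler_wpM2l ?opnorm_ge0 ?le_opnorm.
Qed.

Definition adjoint_fun T (f : dual W) : dual V :=
  BoundedOp (comp_bounded_linear T f).

Lemma adjoint_fun_bounded_linear T :
  adjoint_fun T \in bounded_linear (dual W) (dual V).
Proof.
apply/asboolP; split; first by move=> a f g; exact/val_inj.
exists (opnorm T) => f; apply: (@opnorm_le _ V R[i]^o) => x x1.
rewrite (le_trans (le_opnorm f _))// mulrC.
exact: ler_wpM2r (opnorm_ge0 f) _ _ (le_opnorm1 T x1).
Qed.

Definition adjoint T : bounded_op (dual W) (dual V) :=
  BoundedOp (adjoint_fun_bounded_linear T).

Definition norm_isometry T := forall x, `|T x| = `|x|.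

End adjoint.

Lemma cvg_initialP {S : choiceType} {T : topologicalType} (f : S -> T)
    (F : set_system S) (s : S) : Filter F ->
  F --> (s : initial_topology f) <-> f @ F --> f s.
Proof.
move=> FF; split => [Fs|Ffs A].
  exact: (cvg_comp _ _ Fs (@initial_continuous S T f s)).
rewrite nbhsE => -[_ [[B oB <-] Bfs] BA].
have : (f @ F) B by apply: Ffs; exact: open_nbhs_nbhs.
by rewrite /fmap /=; apply: filterS.
Qed.

Lemma cvg_ptwsP {I : Type} {U : topologicalType} {V : uniformType}
    (F : set_system I) (u : I -> {ptws U -> V}) (g : {ptws U -> V}) :
  Filter F -> u @ F --> g <-> forall x, (fun i => u i x) @ F --> g x.
Proof. by move=> FF; rewrite pointwise_cvgP. Qed.

Section operator_topologies.
Context {R : realType} {X : normedModType R[i]}.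
Variable P : set (bounded_op X X).

Definition sot_map (T : P) : {ptws X -> X} := set_val T : X -> X.

Definition sot := initial_topology sot_map.

Definition sot_star_map (T : P) : {ptws X -> X} * {ptws dual X -> dual X} :=
  (set_val T : X -> X, adjoint (set_val T) : dual X -> dual X).

Definition sot_star := initial_topology sot_star_map.

HB.instance Definition _ := Topological.on sot.
HB.instance Definition _ := Topological.on sot_star.

Lemma sot_cvgP (F : set_system P) (T : P) : Filter F ->
  F --> (T : sot) <->
  forall x : X, (fun S : P => set_val S x) @ F --> set_val T x.
Proof. by move=> FF; rewrite cvg_initialP cvg_ptwsP. Qed.

Lemma sot_star_cvgP (F : set_system P) (T : P) : Filter F ->
  F --> (T : sot_star) <->
  (forall x : X, (fun S : P => set_val S x) @ F --> set_val T x) /\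
  (forall f : dual X,
     (fun S : P => adjoint (set_val S) f) @ F --> adjoint (set_val T) f).
Proof.
move=> FF; rewrite cvg_initialP; split => [h|[h1 h2]].
  split; apply/cvg_ptwsP; first exact: (cvg_comp _ _ h cvg_fst).
  exact: (cvg_comp _ _ h cvg_snd).
have {}h1 : (fun S : P => (sot_star_map S).1) @ F --> (sot_star_map T).1.
  exact/cvg_ptwsP.
have {}h2 : (fun S : P => (sot_star_map S).2) @ F --> (sot_star_map T).2.
  exact/cvg_ptwsP.
exact: (cvg_pair h1 h2).
Qed.

End operator_topologies.

Section ell.
Context {R : realType}.
Variable q : R.

Definition lnorm (x : nat -> R[i]) : \bar R :=
  ('N[counting]_q%:E[EFin \o (fun n => rnorm (x n : R[i]^o))])%E.

Hypothesis q1 : 1 <= q.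

Lemma lnormE x : lnorm x =
  ((\sum_(n <oo) (rnorm (x n : R[i]^o) `^ q)%:E) `^ q^-1)%E.
Proof.
rewrite /lnorm Lnorm_counting ?(lt_le_trans ltr01)//; congr poweR.
by apply: eq_eseriesr => n _; rewrite /= ger0_norm ?rnorm_ge0.
Qed.

Lemma lnormD x y : (lnorm (x + y)%R <= lnorm x + lnorm y)%E.
Proof.
pose u (n : nat) : R := rnorm (x n : R[i]^o).
pose v (n : nat) : R := rnorm (y n : R[i]^o).
apply: (@le_trans _ _ ('N[counting]_q%:E[EFin \o (u \+ v)%R])%E); last first.
  exact: (@minkowski_EFin _ _ _ counting u v q).
rewrite /lnorm !Lnorm_counting ?(lt_le_trans ltr01)//.
have sum_ge0 w : (0 <= \sum_(n <oo) `|(EFin \o w) n|%E `^ q :> \bar R)%E.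
  by apply: nneseries_ge0 => n _ _; exact: poweR_ge0.
apply: gt0_ler_poweR; rewrite ?invr_ge0 ?(le_trans ler01)//.
- by rewrite in_itv /= leey sum_ge0.
- by rewrite in_itv /= leey sum_ge0.
apply: lee_nneseries => [n _ _|n _]; first exact: poweR_ge0.
rewrite /= lee_fin ge0_ler_powR ?nnegrE ?normr_ge0 ?(le_trans ler01 q1)//.
by rewrite !ger0_norm ?addr_ge0 ?rnorm_ge0//; exact: (@rnormD _ R[i]^o).
Qed.

Lemma lnormZ a x : lnorm (a *: x) = ((rnorm (a : R[i]^o))%:E * lnorm x)%E.
Proof.
have q0 : 0 < q by exact: lt_le_trans q1.
rewrite !lnormE (eq_eseriesr (g := fun n =>
  ((rnorm (a : R[i]^o) `^ q)%:E * (rnorm (x n : R[i]^o) `^ q)%:E)%E)); last first.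
  move=> n _; rewrite -EFinM -powRM ?rnorm_ge0//; congr ((_ `^ _)%:E).
  exact: (rnormZ a (x n : R[i]^o)).
rewrite nneseriesZl; last by move=> n _; rewrite lee_fin powR_ge0.
rewrite poweRM ?lee_fin ?powR_ge0//; last first.
  by apply: nneseries_ge0 => n _ _; rewrite lee_fin powR_ge0.
by rewrite poweR_EFin -powRrM mulfV ?gt_eqF// powRr1 ?rnorm_ge0.
Qed.

Lemma lnorm0 : lnorm 0 = 0%E.
Proof.
by rewrite -(scale0r (0 : nat -> R[i])) lnormZ rnorm0 mul0e.
Qed.

Lemma lnorm_ge0 x : (0 <= lnorm x)%E.
Proof. exact: Lnorm_ge0. Qed.

Lemma lnorm_eq0 x : lnorm x = 0%E -> x = 0.
Proof.
have q0 : 0 < q by exact: lt_le_trans q1.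
pose u n := ((rnorm (x n : R[i]^o) `^ q)%:E : \bar R).
have u0 n : (0 <= u n)%E by rewrite lee_fin powR_ge0.
rewrite lnormE => /poweR_eq0_eq0 => /(_ (nneseries_ge0 (fun n _ _ => u0 n))) su0.
apply/funext => n; apply: (@rnorm_eq0 _ R[i]^o).
have : (u n <= 0)%E.
  rewrite -su0 (le_trans _ (nneseries_lim_ge n.+1 (fun n _ _ => u0 n)))//.
  by rewrite big_nat_recr//= leeDr// sume_ge0.
rewrite lee_fin => un0; apply/eqP.
have /eqP : rnorm (x n : R[i]^o) `^ q = 0.
  by apply/eqP; rewrite eq_le un0 powR_ge0.
by rewrite powR_eq0 => /andP[].
Qed.

Definition ell_pred : {pred nat -> R[i]} :=
  [pred x | (lnorm x < +oo)%E].

Lemma ell_submod_closed : submod_closed ell_pred.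
Proof.
split; first by rewrite inE /= lnorm0.
move=> a x y; rewrite !inE /= => xoo yoo.
rewrite (le_lt_trans (lnormD _ _))// lte_add_pinfty// lnormZ.
by rewrite lte_mul_pinfty ?lee_fin ?rnorm_ge0.
Qed.

#[local] HB.instance Definition _ := GRing.isSubmodClosed.Build _ _ ell_pred
  ell_submod_closed.

(* The proof of 1 <= q is a phantom argument: the normed space structure needs
   it (Minkowski), and can only find it in the type. *)
Record ell (phq : 1 <= q) := Ell {
  ell_val :> nat -> R[i];
  ellP : ell_val \in ell_pred }.

HB.instance Definition _ := [isSub for @ell_val q1].
HB.instance Definition _ := [Choice of ell q1 by <:].
HB.instance Definition _ := [SubChoice_isSubLmodule of ell q1 by <:].

Let ell_norm (x : ell q1) : R[i] := (fine (lnorm x))%:C.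

Let fin_lnorm (x : ell q1) : (fine (lnorm x))%:E = lnorm x.
Proof. by rewrite fineK// ge0_fin_numE ?lnorm_ge0//; exact: ellP. Qed.

Let ell_normD x y : ell_norm (x + y) <= ell_norm x + ell_norm y.
Proof.
by rewrite /ell_norm -rmorphD lecR -lee_fin EFinD !fin_lnorm lnormD.
Qed.

Let ell_normZ a x : ell_norm (a *: x) = `|a| * ell_norm x.
Proof.
rewrite /ell_norm -(@rnormE _ R[i]^o) -rmorphM; congr (_%:C).
by apply: EFin_inj; rewrite EFinM !fin_lnorm lnormZ.
Qed.

Let ell_norm_eq0 x : ell_norm x = 0 -> x = 0.
Proof.
move=> /complexI x0; apply/val_inj/lnorm_eq0.
by rewrite -fin_lnorm x0.
Qed.

HB.instance Definition _ := Lmodule_isNormed.Build R[i] (ell q1)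
  ell_normD ell_normZ ell_norm_eq0.

Lemma ell_normE (x : ell q1) : `|x| =
  (fine ((\sum_(n <oo) (rnorm (x n : R[i]^o) `^ q)%:E) `^ q^-1))%:C.
Proof. by rewrite -lnormE. Qed.

End ell.

Section positive_contractions.
Context {R : realType} {q : R} (q1 : 1 <= q).

Definition positive_vec (x : ell q1) := forall n, 0 <= x n.

Definition positive_op (T : bounded_op (ell q1) (ell q1)) :=
  forall x, positive_vec x -> positive_vec (T x).

Definition positive_contractions : set (bounded_op (ell q1) (ell q1)) :=
  [set T | positive_op T /\ `|T| <= 1].

End positive_contractions.

Arguments positive_contractions {R q} q1.

(* Main.v *)
Require Import Defs.
From mathcomp Require Import all_boot all_order all_algebra.
From mathcomp Require Import all_classical all_reals all_analysis.
From mathcomp Require Import complex borel_hierarchy lra.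

(** Let e_k be the canonical basis of l_q and e_k^* the coordinate functionals.
    Call a positive contraction T spreading when both (T e_0)_0 and (T e_0)_1
    are nonzero; both numbers are then positive.

    If T is spreading, the norm of T^* e_0^* is smaller than 1, the norm of
    e_0^*, so T^* is not an isometry ([adjoint_not_isometry]). Indeed, suppose
    that T^* e_0^* has norm 1. By positivity it is almost normed by vectors
    p >= 0 of the unit ball: (T p)_0 is close to 1. As T p lies in the unit
    ball, (T p)_1 is close to 0, and (T p)_1 >= p_0 (T e_0)_1 makes p_0 close
    to 0 as well ([first_coord_cost]). Since p almost misses e_0, adding t e_0
    to p increases the q-th power of the norm by only about t ^ q, whereas the
    first coordinate of the image increases by t (T e_0)_0
    ([first_coord_gain]). As q > 1, the gain exceeds the cost for small t, which
    contradicts the contractivity of T. Positivity is essential in this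
    argument: it keeps the contributions to (T p)_1 from cancelling.

    Being spreading only involves the vector T e_0, hence is an open condition
    for the strong operator topology and for any finer one ([open_spreading]).
    It is dense ([dense_spreading]): if A is a positive contraction mapping e_0
    to (e_0 + e_1) / 2, then (1 - c) T + c A is spreading for 0 < c <= 1, and
    it tends to T, in norm and thus in both topologies, as c tends to 0. An
    open dense set is a dense G_delta set, so spreading operators are typical
    in both topologies. *)

Set Implicit Arguments.
Unset Strict Implicit.
Unset Printing Implicit Defensive.

Import Order.TTheory GRing.Theory Num.Theory.
Import numFieldNormedType.Exports.

Local Open Scope classical_set_scope.
Local Open Scope ring_scope.

Local Notation cabs z := (rnorm (z : (complex _)^o)).

(** * The modulus of complex numbers *)

Section complex_modulus.
Context {R : realType}.
Implicit Types z w : R[i].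

Lemma cabs_ge0_Re z : 0 <= z -> cabs z = complex.Re z.
Proof. by move=> z0; rewrite /rnorm ger0_norm. Qed.

Lemma ge0_complexE z : 0 <= z -> z = ((complex.Re z)%:C)%C.
Proof. by case: z => a b; rewrite lecE /= => /andP[/eqP -> _]. Qed.

Lemma cabsE z : cabs z = Num.sqrt (complex.Re z ^+ 2 + complex.Im z ^+ 2).
Proof. by rewrite /rnorm; case: z => a b. Qed.

Lemma Re_le_cabs z : `|complex.Re z| <= cabs z.
Proof.
by rewrite cabsE -sqrtr_sqr ler_sqrt ?addr_ge0 ?sqr_ge0// lerDl sqr_ge0.
Qed.

Lemma Im_le_cabs z : `|complex.Im z| <= cabs z.
Proof.
by rewrite cabsE -sqrtr_sqr ler_sqrt ?addr_ge0 ?sqr_ge0// lerDr sqr_ge0.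
Qed.

Lemma cabsM z w : cabs (z * w) = cabs z * cabs w.
Proof. exact: (rnormZ z (w : R[i]^o)). Qed.

Lemma cabs_real (a : R) : cabs (a%:C)%C = `|a|.
Proof. by rewrite cabsE /= expr0n /= addr0 sqrtr_sqr. Qed.

Lemma unimodular_rotation z : exists u, cabs u = 1 /\ u * z = ((cabs z)%:C)%C.
Proof.
have [->|z0] := eqVneq z 0.
  by exists 1; split; rewrite ?mulr0 ?rnorm0// (cabs_real 1) normr1.
exists (`|z| / z); split; last by rewrite divfK// (rnormE (z : R[i]^o)).
apply: complexI; rewrite rnormE normrM normrV ?unitfE// normr_id divff//.
by rewrite normr_eq0.
Qed.

Lemma cabsD_ge0 z w : 0 <= z -> 0 <= w -> cabs (z + w) = cabs z + cabs w.
Proof. by move=> z0 w0; rewrite !cabs_ge0_Re ?addr_ge0// raddfD. Qed.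

End complex_modulus.

(** * Norm and coordinates in l_q *)

Section ell_norm.
Context {R : realType} {q : R} (q1 : 1 <= q).
Local Notation lq := (ell q1).
Implicit Types (x y : lq) (u v : nat -> R[i]).

Let q_gt0 : 0 < q. Proof. exact: lt_le_trans q1. Qed.

Lemma rnorm_ell x : (rnorm x)%:E = lnorm q x.
Proof. by rewrite /rnorm /= fineK// ge0_fin_numE ?lnorm_ge0//; exact: ellP. Qed.

Lemma lnorm_le u v :
  (forall n, cabs (u n) <= cabs (v n)) -> (lnorm q u <= lnorm q v)%E.
Proof.
move=> uv; rewrite !lnormE//.
have sum_ge0 w : (0 <= \sum_(n <oo) (cabs (w n) `^ q)%:E)%E.
  by apply: nneseries_ge0 => n _ _; rewrite lee_fin powR_ge0.
apply: gt0_ler_poweR; rewrite ?invr_ge0 ?(ltW q_gt0)//.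
- by rewrite in_itv /= leey sum_ge0.
- by rewrite in_itv /= leey sum_ge0.
apply: lee_nneseries => [n _ _|n _]; rewrite lee_fin ?powR_ge0//.
by rewrite ge0_ler_powR ?nnegrE ?rnorm_ge0// ltW.
Qed.

Lemma ell_pred_dominated u x (C : R) :
  (forall n, cabs (u n) <= C * cabs (x n)) -> u \in ell_pred q.
Proof.
move=> uC; rewrite inE.
apply: (@le_lt_trans _ _ (lnorm q ((C%:C)%C *: (x : nat -> R[i])))).
  apply: lnorm_le => n; rewrite fctE /= cabsM cabs_real.
  by rewrite (le_trans (uC n))// ler_wpM2r ?rnorm_ge0// ler_norm.
rewrite lnormZ// lte_mul_pinfty ?lee_fin ?rnorm_ge0//.
exact: ellP.
Qed.

Lemma rnorm_ell_le x y :
  (forall n, cabs (x n) <= cabs (y n)) -> rnorm x <= rnorm y.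
Proof. by move=> xy; rewrite -lee_fin !rnorm_ell; exact: lnorm_le. Qed.

Lemma rnorm_ell_pow x :
  ((rnorm x `^ q)%:E = \sum_(n <oo) (cabs (x n) `^ q)%:E)%E.
Proof.
rewrite -poweR_EFin rnorm_ell lnormE// -poweRrM mulVf ?gt_eqF// poweRe1//.
by apply: nneseries_ge0 => n _ _; rewrite lee_fin powR_ge0.
Qed.

Lemma rnorm_ell_powD1 x k : ((rnorm x `^ q)%:E =
  (cabs (x k) `^ q)%:E + \sum_(n <oo | n != k) (cabs (x n) `^ q)%:E)%E.
Proof.
rewrite rnorm_ell_pow (@nneseriesD1 _ _ k)// => n _.
by rewrite lee_fin powR_ge0.
Qed.

Lemma cabs_coord_le x k : cabs (x k) <= rnorm x.
Proof.
have : ((cabs (x k) `^ q)%:E <= (rnorm x `^ q)%:E)%E.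
  rewrite (rnorm_ell_powD1 x k) leeDl// nneseries_ge0// => n _ _.
  by rewrite lee_fin powR_ge0.
rewrite lee_fin; apply: contraTT; rewrite -!ltNge => xk.
by rewrite gt0_ltr_powR// nnegrE rnorm_ge0.
Qed.

(** In the unit ball, a vector whose coordinate at 0 has modulus close to 1 has
    a small coordinate at 1. *)
Lemma two_coord_le x :
  cabs (x 0%N) `^ q + cabs (x 1%N) `^ q <= rnorm x `^ q.
Proof.
rewrite -lee_fin rnorm_ell_pow.
apply: le_trans (nneseries_lim_ge 2 _) => [|n _ _]; last first.
  by rewrite lee_fin powR_ge0.
by rewrite !big_nat_recr//= big_nil add0e.
Qed.

(** Changing a single coordinate costs at most the q-th power of its new
    modulus; this is what makes small changes of small coordinates cheap. *)
Lemma rnorm_ell_change1 x y k : (forall n, n != k -> x n = y n) ->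
  rnorm x `^ q <= cabs (x k) `^ q + rnorm y `^ q.
Proof.
move=> xy; rewrite -lee_fin EFinD (rnorm_ell_powD1 x k) leeD2l//.
rewrite (rnorm_ell_powD1 y k) -[leLHS]add0e leeD ?lee_fin ?powR_ge0//.
rewrite (eq_eseriesr (g := fun n => (cabs (y n) `^ q)%:E))// => n nk.
by rewrite xy.
Qed.

Lemma unit_vec_in_ell k : (fun n => (n == k)%:R : R[i]) \in ell_pred q.
Proof.
rewrite inE lnormE// (@nneseriesD1 _ _ k)//; last first.
  by move=> n _; rewrite lee_fin powR_ge0.
rewrite eseries0 => [|n _ /negPf nk]; last by rewrite nk rnorm0 powR0 ?gt_eqF.
by rewrite adde0 poweR_EFin ltry.
Qed.

Definition unit_vec k : lq := Ell q1 (unit_vec_in_ell k).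

Lemma unit_vecE k n : unit_vec k n = (n == k)%:R.
Proof. by []. Qed.

Lemma rnorm_unit_vec k : rnorm (unit_vec k) = 1.
Proof.
have n0 : (rnorm (unit_vec k)) `^ q = 1.
  apply: EFin_inj; rewrite (rnorm_ell_powD1 _ k) unit_vecE eqxx.
  rewrite eseries0 => [|n _ /negPf nk].
    by rewrite adde0 (cabs_real 1) normr1 powR1.
  by rewrite unit_vecE nk rnorm0 powR0 ?gt_eqF.
by move/eqP: n0; rewrite powR_eq1 (gt_eqF q_gt0) ltNge rnorm_ge0 !orbF => /eqP.
Qed.

Lemma ellD x y n : (x + y) n = x n + y n. Proof. by []. Qed.
Lemma ellN x n : (- x) n = - x n. Proof. by []. Qed.
Lemma ellZ a x n : (a *: x) n = a * x n. Proof. by []. Qed.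

End ell_norm.

(** * Positive contractions *)

Section bounded_operator_action.
Context {R : realType} {V W : normedModType R[i]} (T : bounded_op V W).

Lemma bounded_opD x y : T (x + y) = T x + T y. Proof. exact: linearD. Qed.
Lemma bounded_opB x y : T (x - y) = T x - T y. Proof. exact: linearB. Qed.
Lemma bounded_opZ a x : T (a *: x) = a *: T x. Proof. exact: linearZ. Qed.

End bounded_operator_action.

Section positive_operators.
Context {R : realType} {q : R} (q1 : 1 <= q).
Local Notation lq := (ell q1).
Implicit Types (x y : lq) (T : bounded_op lq lq).

Lemma ell_abs_subproof x : (fun n => ((cabs (x n))%:C)%C) \in ell_pred q.
Proof.
apply: (ell_pred_dominated (x := x) (C := 1)) => n.
by rewrite mul1r cabs_real ger0_norm// rnorm_ge0.
Qed.

Definition ell_abs x : lq := Ell q1 (ell_abs_subproof x).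

Lemma cabs_ell_abs x n : cabs (ell_abs x n) = cabs (x n).
Proof. by rewrite /= cabs_real ger0_norm// rnorm_ge0. Qed.

Lemma positive_ell_abs x : positive_vec (ell_abs x).
Proof. by move=> n; rewrite /= ler0c rnorm_ge0. Qed.

Lemma rnorm_ell_abs x : rnorm (ell_abs x) = rnorm x.
Proof.
by apply/eqP; rewrite eq_le !rnorm_ell_le// => n; rewrite cabs_ell_abs.
Qed.

(** With f the real or the imaginary part, this gives the positive vectors
    |x| - Re x and |x| - Im x. *)
Lemma ell_excess_subproof x (f : R[i] -> R) :
  (forall z, `|f z| <= cabs z) ->
  (fun n => ((cabs (x n) - f (x n))%:C)%C) \in ell_pred q.
Proof.
move=> fle; apply: (ell_pred_dominated (x := x) (C := 2)) => n.
rewrite cabs_real (le_trans (ler_normB _ _))//.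
by rewrite ger0_norm ?rnorm_ge0// mulr_natl mulr2n lerD2l.
Qed.

(** Rotate x so that the n-th coordinate of its image is nonnegative, and write
    the rotated vector w as (|x| - A) + i (|x| - B), where A = |x| - Re w and
    B = |x| - Im w are positive vectors. Then T |x|, T A and T B have real
    coordinates, so that (T w)_n = Re (T w)_n = (T |x|)_n - (T A)_n. *)
Lemma positive_op_abs T x n :
  positive_op T -> cabs (T x n) <= cabs (T (ell_abs x) n).
Proof.
move=> T0; have [u [u1 uT]] := unimodular_rotation (T x n).
pose w : lq := u *: x.
pose A : lq := Ell q1 (ell_excess_subproof w (@Re_le_cabs R)).
pose B : lq := Ell q1 (ell_excess_subproof w (@Im_le_cabs R)).
have absw : ell_abs w = ell_abs x.
  by apply/val_inj/funext => k; rewrite /= cabsM u1 mul1r.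
have wE : w = (ell_abs x - A) + ('i)%C *: (ell_abs x - B).
  apply/val_inj/funext => k; rewrite -absw.
  rewrite [LHS](_ : _ = w k)// [RHS](_ : _ =
    ((cabs (w k))%:C - (cabs (w k) - complex.Re (w k))%:C +
     'i * ((cabs (w k))%:C - (cabs (w k) - complex.Im (w k))%:C))%C)//.
  move: (rnorm _) => m; case: (w k) => a b.
  by apply/eqP; rewrite eq_complex /=; apply/andP; split; apply/eqP; lra.
have A0 : positive_vec A.
  by move=> k; rewrite /= ler0c subr_ge0 (le_trans (ler_norm _))// Re_le_cabs.
have B0 : positive_vec B.
  by move=> k; rewrite /= ler0c subr_ge0 (le_trans (ler_norm _))// Im_le_cabs.
have P0 := positive_ell_abs x.
have : T w n = ((cabs (T x n))%:C)%C by rewrite bounded_opZ -uT.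
rewrite wE bounded_opD bounded_opZ !bounded_opB !(ellD, ellZ, ellN).
have := T0 _ A0 n; have := T0 _ B0 n; have := T0 _ P0 n.
move=> p0; rewrite (cabs_ge0_Re p0); move: p0.
case: (T (ell_abs x) n) => p p'; case: (T A n) => a a'; case: (T B n) => b b'.
rewrite !lecE /= => /andP[/eqP p0i _] /andP[/eqP bi _] /andP[/eqP _ a0].
move=> /(congr1 (@complex.Re R)) /=; lra.
Qed.

Lemma contraction_le T x : `|T| <= 1 -> rnorm (T x) <= rnorm x.
Proof.
rewrite bounded_op_normE lecE /= => /andP[_ T1].
by rewrite (le_trans (le_opnorm T x))// ler_piMl// rnorm_ge0.
Qed.

Lemma coord_bounded_linear k :
  (fun x : lq => x k : R[i]^o) \in bounded_linear lq R[i]^o.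
Proof.
apply/asboolP; split; first by [].
by exists 1 => x; rewrite mul1r cabs_coord_le.
Qed.

Definition coord k : dual lq := BoundedOp (coord_bounded_linear k).

Lemma opnorm_coord_ge1 k : 1 <= opnorm (coord k).
Proof.
have := @le_opnorm1 _ _ _ (coord k) (unit_vec q1 k).
by rewrite rnorm_unit_vec lexx /= eqxx (cabs_real 1) normr1; apply.
Qed.

Implicit Types (k : nat) (p : lq).
Local Notation e0 := (unit_vec q1 0).

Let q_gt0 : 0 < q. Proof. exact: lt_le_trans q1. Qed.

Lemma positive_unit_vec k : positive_vec (unit_vec q1 k).
Proof. by move=> n; rewrite unit_vecE ler0n. Qed.

(** Taking moduli of coordinates keeps the norm of a vector and does not
    decrease the moduli of the coordinates of its image. *)
Lemma almost_norming_positive_vec T (m : R) : positive_op T ->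
  m < opnorm (adjoint T (coord 0)) ->
  exists p, [/\ positive_vec p, rnorm p <= 1 & m < cabs (T p 0%N)].
Proof.
move=> T0 /sup_gt[|_ [x /= x1 <-] mx].
  by exists (rnorm (adjoint T (coord 0) 0)), 0; rewrite //= rnorm0.
exists (ell_abs x); split; first exact: positive_ell_abs.
  by rewrite rnorm_ell_abs.
exact: lt_le_trans mx (positive_op_abs _ _ T0).
Qed.

(** By positivity, removing from p its component along e_0 leaves a positive
    vector, whence (T p)_1 >= p_0 (T e_0)_1. *)
Lemma first_coord_cost T p :
  positive_contractions q1 T -> positive_vec p -> rnorm p <= 1 ->
  (cabs (T e0 1%N) * cabs (p 0%N)) `^ q <= 1 - cabs (T p 0%N) `^ q.
Proof.
move=> [T0 T1] p0 p1; have e00 := positive_unit_vec 0.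
have Tp1 : cabs (T e0 1%N) * cabs (p 0%N) <= cabs (T p 1%N).
  pose r : lq := p - p 0%N *: e0.
  have r0 : positive_vec r.
    move=> [|n]; rewrite ellD ellN ellZ /= ?mulr1 ?subrr// mulr0 subr0.
    exact: p0.
  have pE : p = p 0%N *: e0 + r by rewrite addrC subrK.
  rewrite [in leRHS]pE bounded_opD bounded_opZ ellD ellZ.
  rewrite cabsD_ge0 ?mulr_ge0 ?T0//.
  by rewrite cabsM mulrC lerDl rnorm_ge0.
rewrite lerBrDr (@le_trans _ _ (rnorm (T p) `^ q))//.
  apply: le_trans (two_coord_le _); rewrite addrC lerD2l.
  by rewrite ge0_ler_powR ?nnegrE ?mulr_ge0 ?rnorm_ge0 ?(ltW q_gt0).
have <- : 1 `^ q = 1 :> R by rewrite powR1.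
rewrite ge0_ler_powR ?nnegrE ?rnorm_ge0 ?(ltW q_gt0)//.
exact: le_trans (contraction_le _ T1) p1.
Qed.

(** The vector p + t e_0 is mapped by T to a vector whose norm is at least
    (T p)_0 + t (T e_0)_0, and it differs from p in one coordinate only. *)
Lemma first_coord_gain T p (t : R) : 0 <= t ->
  positive_contractions q1 T -> positive_vec p -> rnorm p <= 1 ->
  (cabs (T p 0%N) + t * cabs (T e0 0%N)) `^ q <= 1 + (cabs (p 0%N) + t) `^ q.
Proof.
move=> t0 [T0 T1] p0 p1; have e00 := positive_unit_vec 0.
have t0C : 0 <= (t%:C)%C :> R[i] by rewrite ler0c.
pose y : lq := p + (t%:C)%C *: e0.
have <- : cabs (T y 0%N) = cabs (T p 0%N) + t * cabs (T e0 0%N).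
  rewrite bounded_opD bounded_opZ ellD ellZ cabsD_ge0 ?mulr_ge0 ?T0//.
  by rewrite cabsM cabs_real ger0_norm.
have <- : cabs (y 0%N) = cabs (p 0%N) + t.
  rewrite ellD ellZ unit_vecE cabsD_ge0 ?mulr_ge0 ?p0 ?ler0n//.
  by rewrite mulr1 cabs_real ger0_norm.
apply: (@le_trans _ _ (rnorm y `^ q)).
  rewrite ge0_ler_powR ?nnegrE ?rnorm_ge0 ?(ltW q_gt0)//.
  exact: le_trans (cabs_coord_le _ _) (contraction_le _ T1).
apply: le_trans (@rnorm_ell_change1 _ _ _ _ p 0%N _) _.
  by move=> n /negPf n0; rewrite ellD ellZ unit_vecE n0 mulr0 addr0.
rewrite addrC lerD2r; have <- : 1 `^ q = 1 :> R by rewrite powR1.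
by rewrite ge0_ler_powR ?nnegrE ?rnorm_ge0 ?(ltW q_gt0).
Qed.

(** Membership only involves the vector T e_0, hence is an open condition in
    the strong operator topology. *)
Definition spreading T := T e0 0%N != 0 /\ T e0 1%N != 0.

End positive_operators.

(** * Spreading operators have a non-isometric adjoint *)

Section not_isometric.
Context {R : realType} {q : R} (hq : 1 < q).
Let q1 := ltW hq.
Local Notation lq := (ell q1).
Let q_gt0 : 0 < q. Proof. exact: lt_trans hq. Qed.

(** Since q > 1, the power s ^ q is negligible with respect to s near 0. *)
Lemma exists_powR_eq_mul (c : R) :
  0 < c -> exists2 s : R, 0 < s & s `^ q = c * s.
Proof.
move=> c0; have s0 : 0 < c `^ (q - 1)^-1 by exact: powR_gt0.
exists (c `^ (q - 1)^-1) => //.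
rewrite -[X in _ `^ X = _](subrK 1) powRD; last by rewrite (gt_eqF s0) implybT.
by rewrite -powRrM mulVf ?powRr1 ?(ltW c0) ?(ltW s0)// gt_eqF// subr_gt0.
Qed.

Lemma adjoint_not_isometry (T : bounded_op lq lq) :
  positive_contractions q1 T -> spreading T -> ~ norm_isometry (adjoint T).
Proof.
move=> PT [Ta Tb] iso.
have one_powR r : 1 `^ r = 1 :> R by rewrite powR1.
have cabs_gt0 z : z != 0 -> 0 < cabs (z : R[i]).
  move=> z0; rewrite lt_neqAle rnorm_ge0 andbT eq_sym.
  by apply: contra_neq z0; exact: rnorm_eq0.
set a := T _ 0%N in Ta; set b := T _ 1%N in Tb.
have {}Ta := cabs_gt0 _ Ta; have {}Tb := cabs_gt0 _ Tb.
(* With t = s / 2 and p_0 <= t, the cost (p_0 + t) ^ q is at most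
   s ^ q = t |a| / 2, half of the gain t |a|. *)
have [s s0 sq] : exists2 s : R, 0 < s & s `^ q = cabs a / 4 * s.
  by apply: exists_powR_eq_mul; rewrite divr_gt0.
pose t := s / 2; have t0 : 0 < t by rewrite divr_gt0.
have ta0 : 0 < t * cabs a by exact: mulr_gt0.
have bt0 : 0 < cabs b * t by exact: mulr_gt0.
pose d := Num.min ((cabs b * t) `^ q) 2^-1.
have d0 : 0 < d by rewrite lt_min powR_gt0//= invr_gt0.
have d1 : d <= 2^-1 by rewrite ge_min lexx orbT.
have dbt : d <= (cabs b * t) `^ q by rewrite ge_min lexx.
(* The first bound on (T p)_0 loses a quarter of the gain; the second one
   amounts to 1 - d < (T p)_0 ^ q and yields p_0 < t. *)
pose m := Num.max (1 - t * cabs a / 4) ((1 - d) `^ q^-1).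
have m1 : m < opnorm (adjoint T (coord q1 0)).
  have := iso (coord q1 0); rewrite !bounded_op_normE => /complexI ->.
  apply: lt_le_trans (opnorm_coord_ge1 _ _); rewrite gt_max.
  apply/andP; split; first by move: ta0; clear; lra.
  rewrite -[ltRHS](one_powR q^-1) gt0_ltr_powR ?invr_gt0 ?nnegrE//.
    by move: d1; clear; lra.
  by move: d0; clear; lra.
have [p [p0 p1]] := almost_norming_positive_vec (proj1 PT) m1.
rewrite gt_max => /andP[pa pd].
have {}pd : 1 - d < cabs (T p 0%N) `^ q.
  have d_ge0 : 0 <= 1 - d by move: d1; clear; lra.
  rewrite -[ltLHS]powRr1// -[X in _ `^ X < _](@mulVf _ q) ?gt_eqF//.
  by rewrite powRrM gt0_ltr_powR// nnegrE ?powR_ge0 ?rnorm_ge0.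
have pt : cabs (p 0%N) < t.
  rewrite -(ltr_pM2l Tb) ltNge; apply/negP => le_bt.
  have := first_coord_cost PT p0 p1.
  have : (cabs b * t) `^ q <= (cabs b * cabs (p 0%N)) `^ q.
    apply: ge0_ler_powR; rewrite ?nnegrE ?(ltW q_gt0) ?(ltW bt0)//.
    by rewrite mulr_ge0 ?rnorm_ge0.
  by move: dbt pd; rewrite -/b; clear; lra.
have := first_coord_gain (ltW t0) PT p0 p1; rewrite -/a.
set z := cabs (T p 0%N) + t * cabs a.
have z1 : 1 <= z by move: ta0 pa; rewrite /z; clear; lra.
have zq : z <= z `^ q.
  by rewrite -[leLHS]powRr1 ?(le_trans ler01)// ler_powR.
have ps : (cabs (p 0%N) + t) `^ q <= s `^ q.
  rewrite ge0_ler_powR ?nnegrE ?addr_ge0 ?rnorm_ge0 ?(ltW s0) ?(ltW t0)//.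
    exact: ltW.
  by move: pt; rewrite /t; clear; lra.
have sE : s `^ q = t * cabs a / 2 by rewrite sq /t; clear; lra.
by move: ps zq ta0 pa; rewrite sE /z; clear; lra.
Qed.

End not_isometric.

(** * Density and openness of spreading operators *)

Section harmonic_convex_combination.
Context {R : realType}.

Definition harmonicC (n : nat) : R[i]^o := ((@harmonic R n)%:C)%C.

Lemma harmonicC_gt0 n : 0 < harmonicC n.
Proof. by rewrite (@ltcR R 0) harmonic_gt0. Qed.

Lemma harmonicC_le1 n : harmonicC n <= 1.
Proof. by rewrite lecR /= invf_le1// ler1n. Qed.

Lemma cvg_harmonicC : harmonicC @ \oo --> (0 : R[i]^o).
Proof.
apply/cvgrPdist_lt => e e0.
have {e0}[r r0 ->] : exists2 r : R, 0 < r & e = (r%:C)%C.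
  exists (complex.Re e); last by rewrite -ge0_complexE ?ltW.
  by rewrite -(@ltcR R 0) -ge0_complexE ?ltW.
have /cvgrPdist_lt/(_ r r0) := @cvg_harmonic R.
apply: filterS => n; rewrite !sub0r !normrN.
rewrite !ger0_norm ?harmonic_ge0 ?ltW ?harmonicC_gt0//.
by rewrite ltcR.
Qed.

Lemma cvg_harmonicC_convex (V : normedModType R[i]) (x y : V) :
  (1 - harmonicC n) *: x + harmonicC n *: y @[n --> \oo] --> x.
Proof.
have cvg_1B : (1 - harmonicC n : R[i]^o) @[n --> \oo] --> (1 : R[i]^o).
  rewrite -[X in _ --> X]subr0; apply: cvgB cvg_harmonicC; exact: cvg_cst.
rewrite [X in _ --> X](_ : x = 1 *: x + 0 *: y); last first.
  by rewrite scale1r scale0r addr0.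
by apply: cvgD; [exact: cvgZ cvg_1B (cvg_cst _)
                |exact: cvgZ cvg_harmonicC (cvg_cst _)].
Qed.

End harmonic_convex_combination.

Section spreading_operators.
Context {R : realType} {q : R} (q1 : 1 <= q).
Local Notation lq := (ell q1).
Local Notation P := (positive_contractions q1).
Implicit Types (T A : bounded_op lq lq).

Lemma convex_opE T A (a b : R[i]) x :
  (a *: T + b *: A) x = a *: T x + b *: A x.
Proof. by []. Qed.

Lemma positive_contractions_convex T A (c : R[i]) : 0 <= c -> c <= 1 ->
  P T -> P A -> P ((1 - c) *: T + c *: A).
Proof.
move=> c0 c1 [T0 T1] [A0 A1]; split.
  move=> x x0 n; rewrite convex_opE ellD !ellZ.
  by rewrite addr_ge0// mulr_ge0// ?subr_ge0//; [exact: T0|exact: A0].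
rewrite (le_trans (ler_normD _ _))// !normrZ.
rewrite (ger0_norm c0) ger0_norm ?subr_ge0//.
rewrite -[leRHS](subrK c) lerD// ?ler_piMr// ?subr_ge0//.
Qed.

Lemma adjoint_convex T A (a b : R[i]) (f : dual lq) :
  adjoint (a *: T + b *: A) f = a *: adjoint T f + b *: adjoint A f.
Proof.
apply/val_inj/funext => x.
by rewrite [LHS](_ : _ = f (a *: T x + b *: A x))// bounded_opD !bounded_opZ.
Qed.

Definition midpoint : lq := ((2^-1)%:C)%C *: (unit_vec q1 0 + unit_vec q1 1).

Lemma rnorm_midpoint : rnorm midpoint <= 1.
Proof.
rewrite rnormZ cabs_real ger0_norm ?invr_ge0// ler_pdivrMl// mulr1.
by rewrite (le_trans (rnormD _ _))// !rnorm_unit_vec.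
Qed.

Lemma rank_one_bounded_linear :
  (fun x : lq => x 0%N *: midpoint) \in bounded_linear lq lq.
Proof.
apply/asboolP; split.
  by move=> a x y; rewrite ellD ellZ scalerDl -scalerA.
exists 1 => x; rewrite rnormZ mul1r.
rewrite -[leRHS]mulr1 ler_pM ?rnorm_ge0 ?cabs_coord_le//.
exact: rnorm_midpoint.
Qed.

Definition rank_one : bounded_op lq lq := BoundedOp rank_one_bounded_linear.

Lemma midpoint_ge0 n : 0 <= midpoint n.
Proof.
rewrite ellZ ellD mulr_ge0 ?addr_ge0 ?ler0n//.
by rewrite ler0c invr_ge0.
Qed.

Lemma midpoint_gt0 n : (n < 2)%N -> 0 < midpoint n.
Proof.
move=> n2; rewrite ellZ ellD mulr_gt0 ?(@ltcR R 0) ?invr_gt0//.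
by case: n n2 => [|[|]]//= _; rewrite ?addr0 ?add0r ltr01.
Qed.

Lemma rank_one_contraction : P rank_one.
Proof.
split; first by move=> x x0 n; rewrite ellZ mulr_ge0 ?midpoint_ge0.
rewrite bounded_op_normE lecR; apply: opnorm_le => x x1.
rewrite rnormZ -[leRHS]mulr1 ler_pM ?rnorm_ge0//.
  exact: le_trans (cabs_coord_le _ _) x1.
exact: rnorm_midpoint.
Qed.

Lemma spreading_perturbation T n : P T ->
  spreading ((1 - harmonicC n) *: T + harmonicC n *: rank_one).
Proof.
move=> [T0 _]; have u0 := positive_unit_vec q1 0.
set S := _ + _; suff gt0 k : (k < 2)%N -> 0 < S (unit_vec q1 0) k.
  by split; rewrite gt_eqF// gt0.
move=> k2; rewrite /S.
rewrite convex_opE ellD !ellZ.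
apply: ltr_wpDl; last first.
  by rewrite mulr_gt0 ?harmonicC_gt0// unit_vecE mul1r midpoint_gt0.
by rewrite mulr_ge0 ?subr_ge0 ?harmonicC_le1//; exact: T0.
Qed.

Lemma open_spreading (Z : topologicalType) (op : Z -> bounded_op lq lq) :
  (forall (T : Z) x, op S x @[S --> T] --> op T x) ->
  open [set T | spreading (op T)].
Proof.
move=> op_cont.
suff open_coord k : open [set T | op T (unit_vec q1 0) k != 0].
  rewrite (_ : [set T | _] = [set T | op T (unit_vec q1 0) 0%N != 0] `&`
    [set T | op T (unit_vec q1 0) 1%N != 0])//.
  exact: openI.
rewrite openE => T /= Tk; rewrite /interior.
have /cvgrPdist_lt/(_ _ _)  := op_cont T (unit_vec q1 0).
move=> /(_ `|(op T (unit_vec q1 0) k : R[i]^o)|).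
rewrite normr_gt0 => /(_ Tk); apply: filterS => S.
apply: contraTneq => Sk; rewrite -!rnormE ltcR -leNgt.
by rewrite (le_trans _ (cabs_coord_le _ k))// ellD ellN Sk subr0.
Qed.

(** Stated for any topology on the positive contractions in which pointwise
    convergence of a sequence and of its adjoints implies convergence, so as to
    cover the strong and the strong-star topology at once. *)
Lemma dense_spreading (Z : topologicalType) (op : Z -> bounded_op lq lq) :
  (forall T : Z, P (op T)) ->
  (forall A, P A -> exists T : Z, op T = A) ->
  (forall (u : nat -> Z) (T : Z),
    (forall x, op (u n) x @[n --> \oo] --> op T x) ->
    (forall f, adjoint (op (u n)) f @[n --> \oo] --> adjoint (op T) f) ->
    u n @[n --> \oo] --> T) ->
  dense [set T | spreading (op T)].
Proof.
move=> opP op_surj op_cvg O [T OT] oO.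
have /choice[u uE] : forall n, exists S : Z,
    op S = (1 - harmonicC n) *: op T + harmonicC n *: rank_one.
  move=> n; apply: op_surj; apply: positive_contractions_convex.
  - exact/ltW/harmonicC_gt0.
  - exact: harmonicC_le1.
  - exact: opP.
  - exact: rank_one_contraction.
have uT : u n @[n --> \oo] --> T.
  apply: op_cvg => [x|f].
    under eq_fun do rewrite uE convex_opE.
    exact: cvg_harmonicC_convex.
  under eq_fun do rewrite uE adjoint_convex.
  exact: cvg_harmonicC_convex.
have [n _ nO] : \forall n \near \oo, O (u n).
  by apply: uT; apply: open_nbhs_nbhs.
exists (u n); split; first exact: (nO n (leqnn n)).
by rewrite /= uE; exact: spreading_perturbation.
Qed.

End spreading_operators.

(** * Typical positive contractions *)

Theorem proposition1p3 (R : realType) (q : R) (hq : 1 < q) :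
  comeager [set T : sot (positive_contractions (ltW hq)) |
              ~ norm_isometry (adjoint (set_val T))] /\
  comeager [set T : sot_star (positive_contractions (ltW hq)) |
              ~ norm_isometry (adjoint (set_val T))].
Proof.
have typical (Z : topologicalType) (op : Z -> bounded_op (ell (ltW hq)) _) :
    (forall T, positive_contractions (ltW hq) (op T)) ->
    open [set T | spreading (op T)] -> dense [set T | spreading (op T)] ->
    comeager [set T | ~ norm_isometry (adjoint (op T))].
  move=> opP oU dU; exists [set T | spreading (op T)]; split => //.
    exact: open_Gdelta.
  by move=> T; exact: adjoint_not_isometry.
have surj A : positive_contractions (ltW hq) A ->
    exists T : positive_contractions (ltW hq), set_val T = A.
  by move=> PA; exists (SigSub (mem_set PA)).
have valP (T : positive_contractions (ltW hq)) :
    positive_contractions (ltW hq) (set_val T) by exact: set_mem (valP T).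
split; apply: typical => //.
- apply: open_spreading => T x.
  by have /sot_cvgP/(_ x) : nbhs T --> T by [].
- apply: dense_spreading => // u T uT _; exact/sot_cvgP.
- apply: open_spreading => T x.
  by have /sot_star_cvgP[/(_ x)] : nbhs T --> T by [].
- by apply: dense_spreading => // u T uT uT'; exact/sot_star_cvgP.
Qed.
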